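(* Let $a_1,\dots,a_m\in\mathbb{R}^n$, $b_1,\dots,b_m\in\mathbb{R}$, $B=\{1,\dots,s\}$ with $s\le n$, $c_0,c_1,\dots,c_L\in\mathbb{R}^n$, $\xi^{(1)},\dots,\xi^{(q)}\in\mathbb{R}^L$ with $q\ge 1$, $A_0$ a real symmetric $n\times n$ matrix and $\rho\ge 0$. Consider the robust mixed integer quadratic program $$(RP)\quad \inf_{x\in\mathbb{R}^n}\ \max_{(c,A)\in\mathcal{U}\times\mathcal{V}}\{x^TAx+c^Tx\}\quad\text{s.t.}\quad a_j^Tx=b_j,\ j=1,\dots,m,\quad x\ge 0,\ x_i\in\{0,1\},\ i\in B,$$ where $$\mathcal{U}=\Big\{c_0+\sum_{l=1}^L\xi_l c_l : \xi=(\xi_1,\dots,\xi_L)\in\operatorname{conv}\{\xi^{(1)},\dots,\xi^{(q)}\}\Big\},\qquad \mathcal{V}=\{A_0+V : V \text{ symmetric } n\times n,\ \|V\|_{\rm spec}\le\rho\}.$$ Assume that the feasible set of $(RP)$ is nonempty. Suppose that $$\{d\in\mathbb{R}^n_+ : a_j^Td=0,\ j=1,\dots,m,\ d_i=0,\ i=1,\dots,s\}=\{0_{\mathbb{R}^n}\}$$ and that the following condition (RA) holds: if $d\in\mathbb{R}^n_+$ and $a_j^Td=b_j$ for $j=1,\dots,m$, then $0\le d_i\le 1$ for all $i\in B$. Then $\inf(RP)=\sup(D_{RP})$, where $(D_{RP})$ is the dual problem of $(RP)$ defined in the context.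
   Context: $\|V\|_{\rm spec}=\sqrt{\lambda_{\max}(V^TV)}$ is the spectral norm, $\mathbb{R}^k_+$ is the nonnegative orthant, and $\inf(\cdot)$, $\sup(\cdot)$ denote optimal values. Definition of $(D_{RP})$. Let $C$ be the feasible set of $(RP)$ (compact under the first displayed hypothesis), and let $$M:=\max\Big\{\max_{x\in C,\,1\le k\le q}\Big\{c_0^Tx+\sum_{l=1}^L\xi^{(k)}_l c_l^Tx\Big\},\,0\Big\}<+\infty .$$ Write vectors of $\mathbb{R}^{n+q+4}$ in blocks as elements of $\mathbb{R}^n\times\mathbb{R}\times\mathbb{R}\times\mathbb{R}^{q+2}$, and let $e_1,\dots,e_{q+2}$ be the standard basis of $\mathbb{R}^{q+2}$. Let $W$ be the symmetric $(n+q+4)\times(n+q+4)$ matrix whose upper-left $n\times n$ block is $A_0+\rho I_n$ and all of whose other entries are $0$, and let $w=(0_{\mathbb{R}^n},1,-1,0_{\mathbb{R}^{q+2}})$. Put $\ell=m+q+2$ and define $\overline{a}_j\in\mathbb{R}^{n+q+4}$, $\overline{b}_j\in\mathbb{R}$, $j=1,\dots,\ell$, by $$\overline{a}_j=\begin{cases}(a_j,0,0,0_{\mathbb{R}^{q+2}}), & j=1,\dots,m,\\ \big(c_0+\sum_{l=1}^L\xi^{(j-m)}_l c_l,\,-1,\,1,\,e_{j-m}\big), & j=m+1,\dots,m+q,\\ (0_{\mathbb{R}^n},1,0,e_{q+1}), & j=m+q+1,\\ (0_{\mathbb{R}^n},1,-1,e_{q+2}), & j=m+q+2,\end{cases}$$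 $$\overline{b}_j=\begin{cases} b_j, & j=1,\dots,m,\\ 0, & j=m+1,\dots,m+q,\\ M, & j=m+q+1,\,m+q+2.\end{cases}$$ For $x\in\mathbb{R}^{n+q+4}$ let $f(x)=x^TWx+w^Tx$ and $$g_j(x)=\begin{cases}\overline{a}_j^Tx-\overline{b}_j, & j=1,\dots,\ell,\\ -\overline{a}_{j-\ell}^Tx+\overline{b}_{j-\ell}, & j=\ell+1,\dots,2\ell,\\ (\overline{a}_{j-2\ell}^Tx)^2-\overline{b}_{j-2\ell}^2, & j=2\ell+1,\dots,3\ell,\\ -(\overline{a}_{j-3\ell}^Tx)^2+\overline{b}_{j-3\ell}^2, & j=3\ell+1,\dots,4\ell,\\ x_{j-4\ell}(x_{j-4\ell}-1), & j=4\ell+1,\dots,4\ell+s,\\ -x_{j-4\ell-s}(x_{j-4\ell-s}-1), & j=4\ell+s+1,\dots,4\ell+2s.\end{cases}$$ Then $$(D_{RP})\quad \sup_{u\in\mathbb{R}^{4\ell+2s}_+}\ \inf_{x\in\mathbb{R}^{n+q+4}_+}\Big\{f(x)+\sum_{j=1}^{4\ell+2s}u_jg_j(x)\Big\}.$$ *)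

(* Defs.v *)
From mathcomp Require Import all_boot all_order all_algebra.
From mathcomp Require Import boolp classical_sets reals ereal constructive_ereal.

Set Implicit Arguments.
Unset Strict Implicit.
Unset Printing Implicit Defensive.

Import Order.TTheory GRing.Theory Num.Theory.

Local Open Scope classical_set_scope.
Local Open Scope ring_scope.

Section Vectors.
Context {R : realType}.

Definition dotv n (u v : 'cV[R]_n) : R := (u^T *m v) 0 0.

(* x^T Q x + v^T x *)
Definition quadfun n (Q : 'M[R]_n) (v x : 'cV[R]_n) : R :=
  dotv x (Q *m x) + dotv v x.

Definition orthant n : set 'cV[R]_n := [set x | forall i, 0 <= x i 0].

Definition conv_family (q : nat) (V : lmodType R) (p : 'I_q -> V) : set V :=
  [set v | exists t : 'I_q -> R,
    [/\ forall k, 0 <= t k, \sum_(k < q) t k = 1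
      & v = \sum_(k < q) t k *: p k]].

(* The real [sup] is the maximum here: for symmetric [Q] and [n > 0] the set of
   eigenvalues is finite and nonempty. For [n = 0] it is empty and [sup] is 0. *)
Definition lambda_max n (Q : 'M[R]_n) : R := sup [set l | eigenvalue Q l].

Definition spec_norm n (V : 'M[R]_n) : R :=
  Num.sqrt (lambda_max (V^T *m V)).

End Vectors.

Section RobustProgram.
Context {R : realType} {n m s L q : nat}.
Context (a : 'I_m -> 'cV[R]_n) (b : 'I_m -> R) (hs : (s <= n)%N).
Context (c0 : 'cV[R]_n) (c : 'I_L -> 'cV[R]_n) (xi : 'I_q -> 'cV[R]_L).
Context (A0 : 'M[R]_n) (rho : R).

(* The index set B = {1, ..., s}, embedded in {1, ..., n}. *)
Definition binary_index (i : 'I_s) : 'I_n := widen_ord hs i.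

Definition affine_cost (z : 'cV[R]_L) : 'cV[R]_n :=
  c0 + \sum_(l < L) z l 0 *: c l.

Definition Uset : set 'cV[R]_n := affine_cost @` conv_family xi.

Definition Vset : set 'M[R]_n :=
  [set A0 + V | V in [set V : 'M[R]_n | V^T = V /\ spec_norm V <= rho]].

Definition feasible_RP : set 'cV[R]_n :=
  [set x | [/\ forall j, dotv (a j) x = b j, orthant x
             & forall i, x (binary_index i) 0 = 0 \/ x (binary_index i) 0 = 1]].

Definition worst_case (x : 'cV[R]_n) : \bar R :=
  ereal_sup [set (quadfun cA.2 cA.1 x)%:E | cA in Uset `*` Vset].

Definition inf_RP : \bar R := ereal_inf (worst_case @` feasible_RP).

(* The real [sup] is the maximum when the feasible set is nonempty and compact
   and q >= 1. *)
Definition bigM : R :=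
  Num.max (sup [set dotv (affine_cost (xi xk.2)) xk.1
                 | xk in feasible_RP `*` [set: 'I_q]]) 0.

(* n + q + 4, associated so as to exhibit the blocks
   R^n x R x R x R^(q+2). *)
Definition dualdim : nat := (n + (1 + (1 + (q + 2))))%N.

(* ell = m + q + 2 *)
Definition ell : nat := (m + (q + 2))%N.

Definition blockv (x : 'cV[R]_n) (y z : R) (t : 'cV[R]_(q + 2)) :
    'cV[R]_dualdim :=
  col_mx x (col_mx (const_mx y) (col_mx (const_mx z) t)).

Definition stdbasis (k : 'I_(q + 2)) : 'cV[R]_(q + 2) := delta_mx k 0.

Definition Wmx : 'M[R]_dualdim := block_mx (A0 + rho%:M) 0 0 0.

Definition wvec : 'cV[R]_dualdim := blockv 0 1 (-1) 0.

Definition abar (j : 'I_ell) : 'cV[R]_dualdim :=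
  match split j with
  | inl j => blockv (a j) 0 0 0
  | inr j =>
    match split j with
    | inl k => blockv (affine_cost (xi k)) (-1) 1 (stdbasis (lshift 2 k))
    | inr r => blockv 0 1 (if r == 0 then 0 else -1) (stdbasis (rshift q r))
    end
  end.

Definition bbar (j : 'I_ell) : R :=
  match split j with
  | inl j => b j
  | inr j => match split j with inl _ => 0 | inr _ => bigM end
  end.

(* 4 ell + 2 s *)
Definition nconstr : nat := (ell + (ell + (ell + (ell + (s + s)))))%N.

Definition fdual (x : 'cV[R]_dualdim) : R := quadfun Wmx wvec x.

(* The functions g_j, stacked in the order of the index j. *)
Definition gdual (x : 'cV[R]_dualdim) : 'cV[R]_nconstr :=
  let lin := \col_j (dotv (abar j) x - bbar j) in
  let sqr := \col_j (dotv (abar j) x ^+ 2 - bbar j ^+ 2) in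
  let xB i := x (lshift _ (binary_index i)) 0 in
  let bin := \col_i (xB i * (xB i - 1)) in
  col_mx lin (col_mx (- lin) (col_mx sqr (col_mx (- sqr)
    (col_mx bin (- bin))))).

Definition lagrangian (u : 'cV[R]_nconstr) (x : 'cV[R]_dualdim) : R :=
  fdual x + \sum_(j < nconstr) u j 0 * gdual x j 0.

Definition sup_DRP : \bar R :=
  ereal_sup [set ereal_inf [set (lagrangian u x)%:E | x in @orthant R dualdim]
              | u in @orthant R nconstr].

End RobustProgram.

(* Main.v *)
(* Let P be the polyhedron of the lifted program and f its objective.  For a
   real v below inf(RP) it suffices to find multipliers whose Lagrangian is at
   least v on the orthant, and multipliers turning it into
     f(x) + nu sum_{i in B} x_i (1 - x_i) + mu |A x - b|^2
   are enough.  They come from two exact penalty steps on the compact simplex of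
   homogenized points (t, x) >= 0, t + sum x_i = 1.  On {A x = t b} the trivial
   recession cone forces t > 0, so x / t lies in P; there (RA) makes the nu-term
   nonnegative, and it vanishes exactly at binary points, where f > v.  Penalizing
   |A x - t b|^2 then extends the inequality from {A x = t b} to the whole
   simplex, and homogeneity extends it to the orthant.  Weak duality lifts a
   point of (RP) to one where all g_j vanish; the spectral norm ball enters only
   through max_V x^T V x = rho |x|^2. *)
Require Import Defs.
From mathcomp Require Import all_boot all_order all_algebra.
From mathcomp Require Import boolp classical_sets reals ereal constructive_ereal.
From mathcomp Require Import topology normedtype derive function_spaces.
From mathcomp Require Import ring lra.

Set Implicit Arguments.
Unset Strict Implicit.
Unset Printing Implicit Defensive.

Import Order.TTheory GRing.Theory Num.Theory.
Import numFieldNormedType.Exports.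

Local Open Scope classical_set_scope.
Local Open Scope ring_scope.

(** * Algebra of the dot product *)

Section DotProduct.
Context {R : realType}.

Lemma dotvE n (u v : 'cV[R]_n) : dotv u v = \sum_i u i 0 * v i 0.
Proof. by rewrite /dotv mxE; apply: eq_bigr => i _; rewrite mxE. Qed.

Lemma dotvC n (u v : 'cV[R]_n) : dotv u v = dotv v u.
Proof. by rewrite !dotvE; apply: eq_bigr => i _; rewrite mulrC. Qed.

Lemma dotvDr n (u v w : 'cV[R]_n) : dotv u (v + w) = dotv u v + dotv u w.
Proof. by rewrite /dotv mulmxDr mxE. Qed.

Lemma dotvDl n (u v w : 'cV[R]_n) : dotv (u + v) w = dotv u w + dotv v w.
Proof. by rewrite dotvC dotvDr !(dotvC w). Qed.

Lemma dotvZr n k (u v : 'cV[R]_n) : dotv u (k *: v) = k * dotv u v.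
Proof. by rewrite /dotv -scalemxAr mxE. Qed.

Lemma dotvZl n k (u v : 'cV[R]_n) : dotv (k *: u) v = k * dotv u v.
Proof. by rewrite dotvC dotvZr dotvC. Qed.

Lemma dotv0l n (v : 'cV[R]_n) : dotv 0 v = 0.
Proof. by rewrite -(scale0r (0 : 'cV[R]_n)) dotvZl mul0r. Qed.

Lemma dotv_suml n I (r : seq I) (F : I -> 'cV[R]_n) v :
  dotv (\sum_(i <- r) F i) v = \sum_(i <- r) dotv (F i) v.
Proof.
by elim/big_ind2: _ => [|x1 x2 y1 y2 <- <-|//]; [exact: dotv0l|exact: dotvDl].
Qed.

Lemma dotv_mulmxr n (S : 'M[R]_n) (u v : 'cV[R]_n) :
  dotv u (S *m v) = dotv (S^T *m u) v.
Proof. by rewrite /dotv trmx_mul trmxK mulmxA. Qed.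

Lemma dotv_ge0 n (v : 'cV[R]_n) : 0 <= dotv v v.
Proof. by rewrite dotvE sumr_ge0// => i _; rewrite -expr2 sqr_ge0. Qed.

Lemma dotv_eq0 n (v : 'cV[R]_n) : dotv v v = 0 -> v = 0.
Proof.
rewrite dotvE => /eqP; rewrite psumr_eq0; last by move=> i _; rewrite -expr2 sqr_ge0.
move=> /allP v0; apply/matrixP => i j; rewrite mxE ord1.
by have := v0 i (mem_index_enum i); rewrite /= mulf_eq0 orbb => /eqP.
Qed.

Lemma dotv_scalar n k (v : 'cV[R]_n) : dotv v (k%:M *m v) = k * dotv v v.
Proof. by rewrite mul_scalar_mx dotvZr. Qed.

Lemma dotv_col_mx n1 n2 (u1 v1 : 'cV[R]_n1) (u2 v2 : 'cV[R]_n2) :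
  dotv (col_mx u1 u2) (col_mx v1 v2) = dotv u1 v1 + dotv u2 v2.
Proof. by rewrite /dotv tr_col_mx mul_row_col mxE. Qed.

End DotProduct.

(** * Continuity of forms, and exact penalties on compact sets *)

Section Continuity.
Context {R : realType} {T : topologicalType}.

Lemma continuous_sumr I (r : seq I) (F : I -> T -> R) :
  (forall i, continuous (F i)) -> continuous (fun x => \sum_(i <- r) F i x).
Proof.
by move=> cF; apply: (@continuous_big R^o) => // -[x y]; exact: add_continuous.
Qed.

Lemma continuous_mulr (f g : T -> R) :
  continuous f -> continuous g -> continuous (fun x => f x * g x).
Proof. by move=> cf cg x; exact: (continuousM (cf x) (cg x)). Qed.

Lemma continuous_addr (f g : T -> R) :
  continuous f -> continuous g -> continuous (fun x => f x + g x).
Proof. by move=> cf cg x; exact: (continuousD (cf x) (cg x)). Qed.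

Lemma continuous_oppr (f : T -> R) :
  continuous f -> continuous (fun x => - f x).
Proof. by move=> cf x; exact: (continuousN (cf x)). Qed.

Lemma continuous_dotv n (X Y : T -> 'cV[R]_n) :
  (forall i, continuous (fun v => X v i 0)) ->
  (forall i, continuous (fun v => Y v i 0)) ->
  continuous (fun v => dotv (X v) (Y v)).
Proof.
move=> cX cY; under [X in continuous X]eq_fun do rewrite dotvE.
by apply: continuous_sumr => i; exact: continuous_mulr.
Qed.

Lemma continuous_mulmx_coord n (S : 'M[R]_n) (X : T -> 'cV[R]_n) :
  (forall i, continuous (fun v => X v i 0)) ->
  forall i, continuous (fun v => (S *m X v) i 0).
Proof.
move=> cX i; under [X in continuous X]eq_fun do rewrite mxE.
by apply: continuous_sumr => j; apply: continuous_mulr => //; exact: cst_continuous.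
Qed.

Lemma closed_level (f : T -> R) k : continuous f -> closed [set v | f v = k].
Proof.
by move=> /continuous_closedP cf; apply: (cf [set x | x = k]); exact: closed_eq.
Qed.

Lemma closed_le_level (f : T -> R) k : continuous f -> closed [set v | f v <= k].
Proof.
by move=> /continuous_closedP cf; apply: (cf [set x | x <= k]); exact: closed_le.
Qed.

(** On the compact part [K'] of [K] where [F <= 0], the function [G] has a positive minimum and [F]
    has a minimum; [mu] is chosen so that [mu * G] is at least [1 - min F] there. If [K'] is empty,
    [mu = 0] will do. *)
Lemma penalty (K : set T) (F G : T -> R) :
  compact K -> continuous F -> continuous G ->
  (forall v, K v -> 0 <= G v) -> (forall v, K v -> G v = 0 -> 0 < F v) ->
  exists2 mu, 0 <= mu & forall v, K v -> 0 < F v + mu * G v.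
Proof.
move=> cK cF cG G0 F0.
pose K' := K `&` [set v | F v <= 0].
have cK' : compact K' by apply: compact_closedI => //; exact: closed_le_level.
have [K'0|/set0P K'n0] := eqVneq K' set0.
  exists 0 => // v Kv; rewrite mul0r addr0 ltNge; apply/negP => Fv.
  by have : K' v by []; rewrite K'0.
have [g gK gmin] := compact_EVT_min K'n0 cK' (continuous_subspaceT cG).
have [f fK fmin] := compact_EVT_min K'n0 cK' (continuous_subspaceT cF).
move: gK fK; rewrite !inE => -[Kg Fg] [Kf Ff].
have Gg : 0 < G g.
  rewrite lt_neqAle G0// andbT eq_sym; apply/eqP => /(F0 _ Kg).
  by rewrite ltNge Fg.
have mu0 : 0 <= (1 - F f) / G g.
  by apply: divr_ge0; [rewrite subr_ge0 (le_trans Ff)|exact: ltW].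
exists ((1 - F f) / G g) => // v Kv.
have [Fv|Fv] := leP (F v) 0; last by rewrite ltr_wpDr// mulr_ge0// G0.
have K'v : v \in K' by rewrite inE.
have : (1 - F f) / G g * G g <= (1 - F f) / G g * G v.
  by rewrite ler_wpM2l// gmin.
rewrite divfK ?gt_eqF// => H.
have := fmin _ K'v; lra.
Qed.

End Continuity.

(** * Spectral bounds on quadratic forms *)

Section Rayleigh.
Context {R : realType}.

Lemma linear_le_square (B c : R) :
  (forall e : R, 0 <= e * B *+ 2 + e ^+ 2 * c) -> B = 0.
Proof.
move=> H.
have c0 : 0 <= c by have := H 1; have := H (-1); lra.
have c1 : 0 < 1 + c by lra.
(* Near the minimizer [- B / c], but with a denominator that stays positive when [c = 0]. *)
have := H (- B / (1 + c)).
have -> : - B / (1 + c) * B *+ 2 + (- B / (1 + c)) ^+ 2 * c =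
  - (B ^+ 2 * (2 + c) / (1 + c) ^+ 2) by field; rewrite gt_eqF.
rewrite oppr_ge0 => {}H; apply/eqP; rewrite -sqrf_eq0 eq_le sqr_ge0 andbT.
by move: H; rewrite pmulr_lle0 ?invr_gt0 ?exprn_gt0// pmulr_lle0//; lra.
Qed.

(** [l] is the maximum of the form on the unit sphere, which is compact as a closed subset of the
    cube [[-1, 1]^n]; a maximizer is an eigenvector. *)
Lemma rayleigh n (S : 'M[R]_n) : (0 < n)%N -> S^T = S ->
  exists2 l, eigenvalue S l & forall x, dotv x (S *m x) <= l * dotv x x.
Proof.
move=> n0 symS.
pose K := [set v : 'rV[R]_n | dotv v^T v^T = 1].
have cT i : continuous (fun v : 'rV[R]_n => v^T i 0).
  by under [X in continuous X]eq_fun do rewrite mxE; exact: coord_continuous.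
have cK : compact K.
  have cB := @rV_compact R n (fun=> `[-1, 1]%classic) (fun=> @segment_compact _ _ _).
  apply: subclosed_compact cB _.
    by apply: closed_level; exact: continuous_dotv.
  move=> v; rewrite /K /= dotvE => Kv i; rewrite /= in_itv/= -ler_norml.
  rewrite -(@expr_le1 _ 2)// real_normK ?num_real// -Kv (bigD1 i)//= mxE ord1 -expr2.
  by rewrite lerDl sumr_ge0// => j _; rewrite -expr2 sqr_ge0.
have K0 : K !=set0.
  exists (delta_mx 0 (Ordinal n0)); rewrite /K /= dotvE (bigD1 (Ordinal n0))//=.
  rewrite big1 => [|j /negPf jn]; rewrite !mxE !eqxx ?jn/= ?mul0r//.
  by rewrite mulr1 addr0.
have [|v vK vmax] := compact_EVT_max K0 cK
    (f := fun v : 'rV[R]_n => dotv v^T (S *m v^T)).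
  apply: continuous_subspaceT; apply: continuous_dotv => //.
  exact: continuous_mulmx_coord.
move: vK; rewrite inE /K /= => vv.
set l := dotv _ (S *m v^T) in vmax.
have Sl x : dotv x (S *m x) <= l * dotv x x.
  have [x0|x0] := eqVneq (dotv x x) 0.
    by rewrite (dotv_eq0 x0) !dotv0l mulr0.
  have xx : 0 < dotv x x by rewrite lt_neqAle eq_sym x0 dotv_ge0.
  pose k := (Num.sqrt (dotv x x))^-1.
  have k2 : k ^+ 2 = (dotv x x)^-1 by rewrite exprVn sqr_sqrtr// ltW.
  have /vmax : (k *: x)^T \in K.
    by rewrite inE /K /= trmxK dotvZl dotvZr mulrA -expr2 k2 mulVf.
  rewrite /= trmxK -scalemxAr dotvZl dotvZr mulrA -expr2 k2.
  by rewrite mulrC ler_pdivrMr.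
exists l => //; apply/eigenvalueP; exists v; last first.
  by apply: contra_eq_neq vv => ->; rewrite trmx0 dotv0l eq_sym oner_neq0.
(* The form [y -> l |y|^2 - y^T S y] is nonnegative and vanishes at the
   maximizer [v^T], hence so does its gradient there. *)
have [z zE] : exists z, z = S *m v^T - l *: v^T by eexists.
have z0 : z = 0.
  (* The gradient is [- 2 z], so moving by [e *: z] gives a quadratic in [e] with no constant term
     and linear coefficient [- 2 |z|^2]. *)
  apply/dotv_eq0/eqP; rewrite -oppr_eq0; apply/eqP.
  apply: (@linear_le_square _ (l * dotv z z - dotv z (S *m z))) => e.
  have := Sl (v^T + e *: z); rewrite -subr_ge0; congr (0 <= _).
  have zS : dotv z z = dotv z (S *m v^T) - l * dotv z v^T.
    by rewrite {2}zE -scaleNr dotvDr dotvZr mulNr.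
  have Svz : dotv v^T (S *m z) = dotv z (S *m v^T).
    by rewrite dotv_mulmxr symS dotvC.
  rewrite mulmxDr -scalemxAr !(dotvDl, dotvDr, dotvZl, dotvZr) vv Svz.
  rewrite (dotvC v^T z) zS -/l; ring.
have Sv : S *m v^T = l *: v^T by apply: subr0_eq; rewrite -zE.
by rewrite -[v in LHS]trmxK -[S in LHS]symS -trmx_mul Sv linearZ /= trmxK.
Qed.

(** The [l] of [rayleigh] is an eigenvalue and bounds all the others, so the real [sup] in
    [lambda_max] is a genuine one. For [n = 0] both sides are 0. *)
Lemma lambda_max_ge n (S : 'M[R]_n) (x : 'cV[R]_n) : S^T = S ->
  dotv x (S *m x) <= lambda_max S * dotv x x.
Proof.
case: n S x => [|n] S x symS.
  by rewrite !dotvE !big_ord0 mulr0.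
have [l lS Sl] := rayleigh (ltn0Sn n) symS.
apply: le_trans (Sl x) _; apply: ler_wpM2r; first exact: dotv_ge0.
apply: sup_ubound => //; exists l => k /= /eigenvalueP[v vk v0].
have vv : 0 < dotv v^T v^T.
  rewrite lt_neqAle dotv_ge0 andbT eq_sym; apply: contra_neq v0 => /dotv_eq0 v0.
  by rewrite -[v]trmxK v0 trmx0.
have := Sl v^T; rewrite -{1}symS -trmx_mul vk linearZ /= dotvZr.
by rewrite ler_pM2r.
Qed.

Lemma spec_norm_quad n (V : 'M[R]_n) (r : R) (x : 'cV[R]_n) :
  V^T = V -> spec_norm V <= r -> dotv x (V *m x) <= r * dotv x x.
Proof.
move=> symV Vr; have r0 : 0 <= r by apply: le_trans Vr; exact: sqrtr_ge0.
have VV : dotv (V *m x) (V *m x) <= r ^+ 2 * dotv x x.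
  have -> : dotv (V *m x) (V *m x) = dotv x (V^T *m V *m x).
    by rewrite -mulmxA [RHS]dotv_mulmxr trmxK.
  apply: le_trans (lambda_max_ge _ _) _; first by rewrite trmx_mul trmxK.
  apply: ler_wpM2r; first exact: dotv_ge0.
  (* [Num.sqrt] is 0 on negative arguments, so [lambda_max] is recovered from its root only when
     positive. *)
  have [L0|L0] := leP (lambda_max (V^T *m V)) 0.
    by rewrite (le_trans L0)// sqr_ge0.
  by rewrite -(sqr_sqrtr (ltW L0)) lerXn2r// nnegrE sqrtr_ge0.
(* The AM-GM bound below has to be divided by [r]; for [r = 0] already [V *m x = 0]. *)
have [r_eq0|r_neq0] := eqVneq r 0.
  have /dotv_eq0 -> : dotv (V *m x) (V *m x) = 0.
    by apply/le_anti; rewrite dotv_ge0 (le_trans VV)// r_eq0 expr0n/= mul0r.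
  by rewrite dotvC dotv0l mulr_ge0// dotv_ge0.
have rp : 0 < r by rewrite lt_neqAle eq_sym r_neq0.
(* AM-GM: [0 <= |r x - V x|^2]. *)
have := dotv_ge0 (r *: x - V *m x).
rewrite -scaleN1r !(dotvDl, dotvDr, dotvZl, dotvZr) (dotvC (V *m x) x) => H.
rewrite -(ler_pM2l rp); nra.
Qed.

(** Puts the maximizer [rho I] of the quadratic form into the ball. The only possible eigenvalue of
    [r^2 I] is [r^2]; for [n = 0] there is none and the [sup] is 0. *)
Lemma spec_norm_scalar n (r : R) : 0 <= r -> spec_norm (r%:M : 'M[R]_n) <= r.
Proof.
move=> r0; rewrite /spec_norm tr_scalar_mx mul_scalar_mx scale_scalar_mx.
rewrite -expr2 -[leRHS]ger0_norm// -sqrtr_sqr ler_wsqrtr// /lambda_max.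
set E := [set l | _]; have [->|/set0P E0] := eqVneq E set0.
  by rewrite sup0 sqr_ge0.
apply: ge_sup => // l /= /eigenvalueP[v + v0].
rewrite mul_mx_scalar => /eqP; rewrite -subr_eq0 -scalerBl scaler_eq0 (negPf v0).
by rewrite orbF subr_eq0 => /eqP ->.
Qed.

End Rayleigh.

(** * Homogenized program on the simplex and its two penalties *)

(* A point [(t, x)] of the homogenized space is a row of length [1 + N]. *)
Section Homogenization.
Context {R : realType} {N p s : nat}.
Context (A : 'I_p -> 'cV[R]_N) (b : 'I_p -> R) (B : 'I_s -> 'I_N).
Implicit Types (v : 'rV[R]_N.+1) (x : 'cV[R]_N).

Definition hscale v : R := v 0 ord0.
Definition hpoint v : 'cV[R]_N := \col_i v 0 (lift ord0 i).
Definition simplex : set 'rV[R]_N.+1 :=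
  [set v | (forall i, 0 <= v 0 i) /\ \sum_i v 0 i = 1].
(** Together with [binary_gap], the degree-two homogenizations of [|A x - b|^2] and of the sum of
    the [x_i (1 - x_i)]. *)
Definition residual v : R :=
  \sum_j (dotv (A j) (hpoint v) - b j * hscale v) ^+ 2.
Definition binary_gap v : R :=
  \sum_i hpoint v (B i) 0 * (hscale v - hpoint v (B i) 0).

Lemma continuous_hscale : continuous hscale.
Proof. exact: coord_continuous. Qed.

Lemma continuous_hpoint i : continuous (fun v => hpoint v i 0).
Proof.
by under [X in continuous X]eq_fun do rewrite mxE; exact: coord_continuous.
Qed.

Lemma continuous_dotv_hpoint (u : 'cV[R]_N) :
  continuous (fun v => dotv u (hpoint v)).
Proof.
apply: continuous_dotv => [i|]; [exact: cst_continuous|exact: continuous_hpoint].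
Qed.

Lemma continuous_residual : continuous residual.
Proof.
apply: continuous_sumr => j.
by apply: continuous_mulr; (apply: continuous_addr;
  [exact: continuous_dotv_hpoint|apply: continuous_oppr; apply: continuous_mulr;
    [exact: cst_continuous|exact: continuous_hscale]]).
Qed.

Lemma continuous_binary_gap : continuous binary_gap.
Proof.
apply: continuous_sumr => i; apply: continuous_mulr.
  exact: continuous_hpoint.
apply: continuous_addr; first exact: continuous_hscale.
by apply: continuous_oppr; exact: continuous_hpoint.
Qed.

Lemma compact_simplex : compact simplex.
Proof.
have cB := @rV_compact R N.+1 (fun=> `[0, 1]%classic)
  (fun=> @segment_compact _ _ _).
apply: subclosed_compact cB _.
  have -> : simplex = (\bigcap_i [set v | - v 0 i <= 0]) `&`
      [set v | \sum_i v 0 i = 1].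
    apply/seteqP; split => v [v0 v1]; split => // i; first by move=> _ /=; rewrite oppr_le0.
    by have := v0 i I; rewrite /= oppr_le0.
  apply: closedI; last first.
    by apply: closed_level; apply: continuous_sumr => i; exact: coord_continuous.
  apply: closed_bigI => i _; apply: closed_le_level; apply: continuous_oppr.
  exact: coord_continuous.
move=> v [v0 v1] i /=; rewrite in_itv/= v0/= -v1 (bigD1 i)//=.
by rewrite lerDl sumr_ge0.
Qed.

Lemma simplex_orthant v : simplex v -> orthant (hpoint v).
Proof. by move=> [v0 _] i; rewrite mxE. Qed.

Lemma residual_ge0 v : 0 <= residual v.
Proof. by apply: sumr_ge0 => j _; exact: sqr_ge0. Qed.

Lemma residual_eq0 v : residual v = 0 ->
  forall j, dotv (A j) (hpoint v) = b j * hscale v.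
Proof.
move=> /eqP; rewrite psumr_eq0; last by move=> j _; exact: sqr_ge0.
move=> /allP r0 j; have := r0 j (mem_index_enum j).
by rewrite /= sqrf_eq0 subr_eq0 => /eqP.
Qed.

(** Normalizes [(1, x)] by its coordinate sum; inequalities on the compact simplex return to the
    unbounded orthant this way. *)
Lemma simplex_ray x : orthant x ->
  exists v, [/\ simplex v, 0 < hscale v & hpoint v = hscale v *: x].
Proof.
move=> x0.
have k1 : 0 < 1 + \sum_i x i 0 by rewrite ltr_wpDr// sumr_ge0.
pose k := (1 + \sum_i x i 0)^-1.
have k0 : 0 < k by rewrite invr_gt0.
exists (\row_i if unlift ord0 i is Some j then k * x j 0 else k).
have t : hscale (\row_i if unlift ord0 i is Some j then k * x j 0 else k) = k.
  by rewrite /hscale mxE unlift_none.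
split; rewrite ?t//; last by apply/matrixP => i j; rewrite !mxE ord1 liftK.
split => [i|].
  by rewrite mxE; case: unliftP => [j _|_]; rewrite ?mulr_ge0// ltW.
rewrite big_ord_recl mxE unlift_none.
under eq_bigr do rewrite mxE liftK.
by rewrite -mulr_sumr -[X in X + _](mulr1 k) -mulrDr mulVf// gt_eqF.
Qed.

Hypothesis trivial_recession :
  forall d, orthant d -> (forall j, dotv (A j) d = 0) -> d = 0.

(** If [t = 0], then [x] is a recession direction, hence 0, and the coordinates cannot sum to 1. *)
Lemma residual0_scale v : simplex v -> residual v = 0 -> 0 < hscale v.
Proof.
move=> sv rv; have [v0 v1] := sv; rewrite lt_neqAle eq_sym [0 <= _]v0 andbT.
apply/eqP => t0.
have x0 : hpoint v = 0.
  apply: trivial_recession; first exact: simplex_orthant.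
  by move=> j; rewrite (residual_eq0 rv) t0 mulr0.
move: v1; rewrite big_ord_recl [v 0 ord0]t0 big1 => [/eqP|i _].
  by rewrite addr0 eq_sym oner_eq0.
by have := congr1 (fun y : 'cV[R]_N => y i 0) x0; rewrite !mxE.
Qed.

Lemma residual0_point v : simplex v -> residual v = 0 ->
  exists x, [/\ orthant x, forall j, dotv (A j) x = b j
               & hpoint v = hscale v *: x].
Proof.
move=> sv rv; have t0 := residual0_scale sv rv.
exists ((hscale v)^-1 *: hpoint v); split.
- by move=> i; rewrite mxE; apply: mulr_ge0; [rewrite invr_ge0 ltW|exact: simplex_orthant].
- by move=> j; rewrite dotvZr (residual_eq0 rv) mulrCA mulVf ?mulr1// gt_eqF.
- by rewrite scalerA divff ?scale1r// gt_eqF.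
Qed.

Lemma residual0_compact : compact (simplex `&` [set v | residual v = 0]).
Proof.
apply: compact_closedI; first exact: compact_simplex.
by apply: closed_level; exact: continuous_residual.
Qed.

Lemma residual_ray v x : hpoint v = hscale v *: x ->
  residual v = hscale v ^+ 2 * \sum_j (dotv (A j) x - b j) ^+ 2.
Proof.
move=> xE; rewrite /residual mulr_sumr; apply: eq_bigr => j _.
by rewrite xE dotvZr; ring.
Qed.

Lemma binary_gap_ray v x : hpoint v = hscale v *: x ->
  binary_gap v = hscale v ^+ 2 * \sum_i x (B i) 0 * (1 - x (B i) 0).
Proof.
move=> xE; rewrite /binary_gap mulr_sumr; apply: eq_bigr => i _.
by rewrite xE !mxE; ring.
Qed.

(** [penalty] with [G = hscale], which vanishes nowhere on the compact set: it yields
    [0 < - u^T x + M t], to be divided by [t]. *)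
Lemma linear_bounded (u : 'cV[R]_N) : exists M : R,
  forall x, orthant x -> (forall j, dotv (A j) x = b j) -> dotv u x <= M.
Proof.
have [||v Kv|v [sv rv] t0|M M0 HM] := penalty residual0_compact
    (F := fun v => - dotv u (hpoint v)) (G := hscale).
- by apply: continuous_oppr; exact: continuous_dotv_hpoint.
- exact: continuous_hscale.
- by have [[v0 _] _] := Kv; exact: v0.
- by have := residual0_scale sv rv; rewrite t0 ltxx.
exists M => x x0 Ax; have [v [sv t0 xE]] := simplex_ray x0.
have rv : residual v = 0.
  rewrite (residual_ray xE) big1 ?mulr0// => j _.
  by rewrite Ax subrr expr0n.
have := HM v (conj sv rv); rewrite xE dotvZr => H.
by rewrite -(ler_pM2l t0); lra.
Qed.

Hypothesis unit_bounds : forall x, orthant x ->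
  (forall j, dotv (A j) x = b j) -> forall i, 0 <= x (B i) 0 <= 1.

Lemma quadratic_penalty (Q : 'M[R]_N) (w : 'cV[R]_N) (val : R) :
  (forall x, orthant x -> (forall j, dotv (A j) x = b j) ->
     (forall i, x (B i) 0 = 0 \/ x (B i) 0 = 1) -> val < quadfun Q w x) ->
  exists nu mu, [/\ 0 <= nu, 0 <= mu &
    forall x, orthant x ->
      val <= quadfun Q w x + nu * (\sum_i x (B i) 0 * (1 - x (B i) 0))
             + mu * \sum_j (dotv (A j) x - b j) ^+ 2].
Proof.
move=> valF.
(* The homogenization [t^2 (f(x / t) - val)] of the objective gap. *)
pose F v := dotv (hpoint v) (Q *m hpoint v) + hscale v * dotv w (hpoint v)
  - val * hscale v ^+ 2.
have cF : continuous F.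
  apply: continuous_addr; first apply: continuous_addr.
  - apply: continuous_dotv; first exact: continuous_hpoint.
    by apply: continuous_mulmx_coord; exact: continuous_hpoint.
  - apply: continuous_mulr; first exact: continuous_hscale.
    exact: continuous_dotv_hpoint.
  - apply: continuous_oppr; apply: continuous_mulr; first exact: cst_continuous.
    by apply: continuous_mulr; exact: continuous_hscale.
have FE v x : hpoint v = hscale v *: x ->
    F v = hscale v ^+ 2 * (quadfun Q w x - val).
  by move=> xE; rewrite /F /quadfun xE -scalemxAr !(dotvZl, dotvZr); ring.
(* First penalty, on the zero set of [residual]: [unit_bounds] makes each term of the gap
   nonnegative, so a zero gap forces binary coordinates. *)
have [||nu nu0 Hnu] := penalty residual0_compact cF continuous_binary_gap.
- move=> v [sv rv]; have [x [x0 Ax xE]] := residual0_point sv rv.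
  rewrite (binary_gap_ray xE) mulr_ge0 ?sqr_ge0// sumr_ge0// => i _.
  by have /andP[xi0 xi1] := unit_bounds x0 Ax i; rewrite mulr_ge0// subr_ge0.
- move=> v [sv rv]; have [x [x0 Ax xE]] := residual0_point sv rv.
  have t2 : 0 < hscale v ^+ 2 by rewrite exprn_gt0// residual0_scale.
  rewrite (binary_gap_ray xE) => /eqP; rewrite mulf_eq0 gt_eqF//= psumr_eq0.
    move=> /allP xB; rewrite (FE v x)// mulr_gt0// subr_gt0; apply: valF => // i.
    have := xB i (mem_index_enum i); rewrite /= mulf_eq0 => /orP[/eqP|]; first by left.
    by rewrite subr_eq0 eq_sym => /eqP; right.
  move=> i _; have /andP[xi0 xi1] := unit_bounds x0 Ax i.
  by rewrite mulr_ge0// subr_ge0.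
(* Second penalty, on the whole simplex with [nu] fixed; its hypothesis on the zero set is [Hnu]. *)
have [|||mu mu0 Hmu] := penalty compact_simplex
    (F := fun v => F v + nu * binary_gap v) _ continuous_residual.
- apply: continuous_addr => //; apply: continuous_mulr; first exact: cst_continuous.
  exact: continuous_binary_gap.
- by move=> v _; exact: residual_ge0.
- by move=> v sv rv; exact: Hnu.
exists nu, mu; split => // x x0; have [v [sv t0 xE]] := simplex_ray x0.
(* All three terms carry the positive factor [t^2], which cancels. *)
have := Hmu v sv.
rewrite (FE v x)// (binary_gap_ray xE) (residual_ray xE).
rewrite mulrCA -mulrDr mulrCA -mulrDr pmulr_rgt0 ?exprn_gt0// => H.
by rewrite -subr_ge0; apply: ltW; lra.
Qed.

End Homogenization.

(** * Worst case of the objective over the uncertainty sets *)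

Section RobustObjective.
Context {R : realType} {n L q : nat}.
Context (c0 : 'cV[R]_n) (c : 'I_L -> 'cV[R]_n) (xi : 'I_q -> 'cV[R]_L).
Context (A0 : 'M[R]_n) (rho : R) (rho_ge0 : 0 <= rho).

Lemma affine_cost_conv (t : 'I_q -> R) : \sum_k t k = 1 ->
  affine_cost c0 c (\sum_k t k *: xi k)
  = \sum_k t k *: affine_cost c0 c (xi k).
Proof.
move=> t1; under [RHS]eq_bigr do rewrite scalerDr.
rewrite big_split /= -scaler_suml t1 scale1r; congr (_ + _).
under [RHS]eq_bigr do rewrite scaler_sumr.
rewrite exchange_big /=; apply: eq_bigr => l _.
rewrite summxE scaler_suml; apply: eq_bigr => k _.
by rewrite mxE scalerA.
Qed.

(** The matrix and cost parts are bounded separately: the spectral bound gives [rho |x|^2], and a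
    convex combination of vertex costs is at most [t]. *)
Lemma worst_case_le (x : 'cV[R]_n) (t : R) :
  (forall k, dotv (affine_cost c0 c (xi k)) x <= t) ->
  (worst_case c0 c xi A0 rho x
     <= (dotv x ((A0 + rho%:M) *m x) + t)%:E)%E.
Proof.
move=> xt; apply: ge_ereal_sup => _ [[u M] /= [Uu [V [symV Vrho] <-]] <-].
rewrite lee_fin /quadfun; apply: lerD.
  rewrite !mulmxDl !dotvDr dotv_scalar lerD2l.
  exact: spec_norm_quad.
case: Uu => _ [p [p0 p1 ->]] <-; rewrite affine_cost_conv// dotv_suml.
rewrite -[t]mul1r -p1 mulr_suml; apply: ler_sum => k _.
by rewrite dotvZl ler_wpM2l.
Qed.

(** Evaluates the objective at the vertex [xi k] and at [V = rho I]. *)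
Lemma worst_case_ge (x : 'cV[R]_n) (k : 'I_q) :
  ((dotv x ((A0 + rho%:M) *m x) + dotv (affine_cost c0 c (xi k)) x)%:E
     <= worst_case c0 c xi A0 rho x)%E.
Proof.
apply: ereal_sup_ubound; exists (affine_cost c0 c (xi k), A0 + rho%:M) => //.
split => /=.
  exists (xi k) => //; exists (fun j => (j == k)%:R); split => //.
  - by rewrite (bigD1 k)//= eqxx big1 ?addr0// => j /negPf ->.
  - rewrite (bigD1 k)//= eqxx scale1r big1 ?addr0// => j /negPf ->.
    by rewrite scale0r.
by exists rho%:M => //; split; [rewrite tr_scalar_mx|exact: spec_norm_scalar].
Qed.

End RobustObjective.

(** * The lifted program in block coordinates and its Lagrangian *)

Section LiftedProgram.
Context {R : realType} {n m s L q : nat}.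
Context (a : 'I_m -> 'cV[R]_n) (b : 'I_m -> R) (hs : (s <= n)%N).
Context (c0 : 'cV[R]_n) (c : 'I_L -> 'cV[R]_n) (xi : 'I_q -> 'cV[R]_L).
Context (A0 : 'M[R]_n) (rho : R).

Local Notation cost k := (affine_cost c0 c (xi k)).
Local Notation A := (abar a c0 c xi).
Local Notation bb := (bbar a b hs c0 c xi).
Local Notation M := (bigM a b hs c0 c xi).
Local Notation Q := (A0 + rho%:M).

Lemma blockv_surj (X : 'cV[R]_(@dualdim n q)) :
  exists x y z t, X = blockv x y z t.
Proof.
exists (usubmx X), (usubmx (dsubmx X) 0 0),
  (usubmx (dsubmx (dsubmx X)) 0 0), (dsubmx (dsubmx (dsubmx X))).
have const1 (Y : 'cV[R]_1) : const_mx (Y 0 0) = Y.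
  by apply/matrixP => i j; rewrite mxE !ord1.
by rewrite /blockv !const1 !vsubmxK.
Qed.

Lemma dotv_blockv (x x' : 'cV[R]_n) y y' z z' (t t' : 'cV[R]_(q + 2)) :
  dotv (blockv x y z t) (blockv x' y' z' t')
  = dotv x x' + (y * y' + (z * z' + dotv t t')).
Proof.
by rewrite /blockv !dotv_col_mx !(dotvE (const_mx _)) !big_ord1 !mxE.
Qed.

Lemma orthant_col_mx n1 n2 (u : 'cV[R]_n1) (v : 'cV[R]_n2) :
  orthant (col_mx u v) <-> orthant u /\ orthant v.
Proof.
split => [uv|[u0 v0] i]; last first.
  by case: (split_ordP i) => j ->; rewrite ?col_mxEu ?col_mxEd.
split => i; first by have := uv (lshift _ i); rewrite col_mxEu.
by have := uv (rshift _ i); rewrite col_mxEd.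
Qed.

Lemma orthant_const_mx k (y : R) : 0 <= y -> @orthant R k (const_mx y).
Proof. by move=> y0 i; rewrite mxE. Qed.

Lemma orthant_blockv (x : 'cV[R]_n) y z (t : 'cV[R]_(q + 2)) :
  orthant (blockv x y z t) <-> [/\ orthant x, 0 <= y, 0 <= z & orthant t].
Proof.
rewrite /blockv !orthant_col_mx; split => [[x0 [y0 [z0 t0]]]|[x0 y0 z0 t0]].
  by split => //; [have := y0 0|have := z0 0]; rewrite mxE.
by do ![split=> //]; exact: orthant_const_mx.
Qed.

Lemma dotv_stdbasis k (t : 'cV[R]_(q + 2)) : dotv (stdbasis k) t = t k 0.
Proof.
rewrite dotvE (bigD1 k)//= big1 => [|i /negPf ik].
  by rewrite mxE !eqxx mul1r addr0.
by rewrite mxE ik mul0r.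
Qed.

Lemma fdual_blockv x y z t :
  fdual A0 rho (blockv x y z t : 'cV_(@dualdim n q)) = dotv x (Q *m x) + (y - z).
Proof.
rewrite /fdual /quadfun dotv_blockv !dotv0l mul1r mulN1r add0r addr0.
congr (_ + _); rewrite /blockv /Wmx mul_block_col !mul0mx !addr0.
by rewrite dotv_col_mx (dotvC _ 0) dotv0l addr0.
Qed.

(** The right-hand side stays arbitrary to serve both feasibility ([bbar]) and recession directions
    (0). *)
Lemma abar_blockvP (rhs : 'I_(@ell m q) -> R) (x : 'cV[R]_n) y z t :
  (forall j, dotv (A j) (blockv x y z t) = rhs j) <->
  [/\ forall j, dotv (a j) x = rhs (lshift _ j),
      forall k, dotv (cost k) x - y + z + t (lshift 2 k) 0
                = rhs (rshift m (lshift 2 k)),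
      y + t (rshift q 0) 0 = rhs (rshift m (rshift q 0))
    & y - z + t (rshift q 1) 0 = rhs (rshift m (rshift q 1))].
Proof.
have Al j : dotv (A (lshift _ j)) (blockv x y z t) = dotv (a j) x.
  (* Reading the injection as [unsplit] lets [unsplitK] evaluate the [split] in [abar]. *)
  rewrite /abar -[lshift _ j]/(unsplit (inl j)) unsplitK.
  by rewrite dotv_blockv dotv0l !mul0r !addr0.
have Am k : dotv (A (rshift m (lshift 2 k))) (blockv x y z t) =
    dotv (cost k) x - y + z + t (lshift 2 k) 0.
  rewrite /abar -[rshift m _]/(unsplit (inr (lshift 2 k))) unsplitK.
  rewrite -{1}[lshift 2 k]/(unsplit (inl k)) unsplitK.
  by rewrite dotv_blockv dotv_stdbasis mulN1r mul1r !addrA.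
have Ar (r : 'I_2) : dotv (A (rshift m (rshift q r))) (blockv x y z t) =
    y + (if r == 0 then 0 else - z) + t (rshift q r) 0.
  rewrite /abar -[rshift m _]/(unsplit (inr (rshift q r))) unsplitK.
  rewrite -{1}[rshift q r]/(unsplit (inr r)) unsplitK.
  rewrite dotv_blockv dotv_stdbasis dotv0l add0r mul1r addrA.
  by case: (r == 0); rewrite ?mul0r ?mulN1r.
split => [H|[Hl Hm H0 H1] j].
  split=> [j|k||]; rewrite -H ?Al ?Am ?Ar ?addr0//=.
case: (split_ordP j) => {}j ->; first by rewrite Al.
case: (split_ordP j) => [k ->|r ->]; first by rewrite Am.
case: r => -[|[|//]] r.
  have -> : Ordinal r = 0 by exact: val_inj.
  by rewrite Ar addr0.
have -> : Ordinal r = 1 by exact: val_inj.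
by rewrite Ar.
Qed.

Lemma bbar_lshift j : bb (lshift _ j) = b j.
Proof. by rewrite /bbar -[lshift _ j]/(unsplit (inl j)) unsplitK. Qed.

Lemma bbar_epi k : bb (rshift m (lshift 2 k)) = 0.
Proof.
rewrite /bbar -[rshift m _]/(unsplit (inr (lshift 2 k))) unsplitK.
by rewrite -[lshift 2 k]/(unsplit (inl k)) unsplitK.
Qed.

Lemma bbar_bound r : bb (rshift m (rshift q r)) = M.
Proof.
rewrite /bbar -[rshift m _]/(unsplit (inr (rshift q r))) unsplitK.
by rewrite -[rshift q r]/(unsplit (inr r)) unsplitK.
Qed.

Lemma abar_bbarP (x : 'cV[R]_n) y z t :
  (forall j, dotv (A j) (blockv x y z t) = bb j) <->
  [/\ forall j, dotv (a j) x = b j,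
      forall k, dotv (cost k) x - y + z + t (lshift 2 k) 0 = 0,
      y + t (rshift q 0) 0 = M & y - z + t (rshift q 1) 0 = M].
Proof.
rewrite abar_blockvP !bbar_bound.
by split => -[H1 H2 H3 H4]; split => // i; rewrite ?H1 ?H2 ?bbar_lshift ?bbar_epi.
Qed.

Definition binary_coord (i : 'I_s) : 'I_(@dualdim n q) :=
  lshift _ (binary_index hs i).

Lemma blockv_binary_coord (x : 'cV[R]_n) y z (t : 'cV[R]_(q + 2)) i :
  blockv x y z t (binary_coord i) 0 = x (binary_index hs i) 0.
Proof. by rewrite /blockv /binary_coord col_mxEu. Qed.

Lemma lagrangianE u X : lagrangian a b hs c0 c xi A0 rho u X =
  fdual A0 rho X + dotv u (gdual a b hs c0 c xi X).
Proof. by rewrite dotvE. Qed.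

Lemma lagrangian_feasible u X : (forall j, dotv (A j) X = bb j) ->
  (forall i, X (binary_coord i) 0 = 0 \/ X (binary_coord i) 0 = 1) ->
  lagrangian a b hs c0 c xi A0 rho u X = fdual A0 rho X.
Proof.
move=> AX XB; rewrite lagrangianE.
have -> : gdual a b hs c0 c xi X = 0; last by rewrite dotvC dotv0l addr0.
have XB0 i : X (binary_coord i) 0 * (X (binary_coord i) 0 - 1) = 0.
  by case: (XB i) => ->; rewrite ?mul0r// subrr mulr0.
apply/matrixP => i j; rewrite /gdual [RHS]mxE.
(* Five splits separate the six blocks of [gdual]; each vanishes. *)
by do 5 (rewrite mxE; case: split => {}i;
  first by rewrite !mxE ?AX ?XB0 ?subrr ?oppr0); rewrite !mxE XB0 oppr0.
Qed.

(* With [lambda = - 2 mu bbar] split into its positive and negative parts, the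
   linear and squared constraints add up to [mu |A X - bbar|^2]. *)
Definition penalty_multiplier (nu mu : R) : 'cV[R]_(@nconstr m s q) :=
  col_mx (\col_j Num.max (- (2 * mu * bb j)) 0)
   (col_mx (\col_j Num.max (2 * mu * bb j) 0)
    (col_mx (const_mx mu) (col_mx 0 (col_mx 0 (const_mx nu))))).

Lemma orthant_penalty_multiplier nu mu : 0 <= nu -> 0 <= mu ->
  orthant (penalty_multiplier nu mu).
Proof.
move=> nu0 mu0; rewrite /penalty_multiplier !orthant_col_mx.
do ![split] => i; rewrite ?mxE// le_max lexx orbT//.
Qed.

(** With [d] the value of a row at [X], [mu (d^2 - bbar^2) - 2 mu bbar (d - bbar) = mu (d -
    bbar)^2]; the last block contributes the [nu] term. *)
Lemma lagrangian_penalty nu mu X :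
  lagrangian a b hs c0 c xi A0 rho (penalty_multiplier nu mu) X =
  fdual A0 rho X
  + nu * (\sum_i X (binary_coord i) 0 * (1 - X (binary_coord i) 0))
  + mu * \sum_j (dotv (A j) X - bb j) ^+ 2.
Proof.
rewrite lagrangianE /gdual /penalty_multiplier !dotv_col_mx !dotv0l !add0r.
rewrite -[RHS]addrA; congr (_ + _).
rewrite !addrA addrC !dotvE !mulr_sumr -!big_split /=; congr (_ + _).
  by apply: eq_bigr => i _; rewrite !mxE /binary_coord; ring.
apply: eq_bigr => j _; rewrite !mxE -/(bb j).
have maxN (r : R) : Num.max (- r) 0 = Num.max r 0 - r.
  by rewrite maxr_absE (maxr_absE r) subr0 normrN subr0; field.
by rewrite maxN; ring.
Qed.

End LiftedProgram.

(** Reduces strong duality to real [v] below the infimum, whether or not that infimum is finite. *)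
Lemma lee_real_lt (R : realType) (x y : \bar R) :
  (forall v : R, (v%:E < x)%E -> (v%:E <= y)%E) -> (x <= y)%E.
Proof.
case: x => [r| |] H; last exact: leNye.
  apply/lee_subgt0Pr => e e0; rewrite -EFinB; apply: H.
  by rewrite lte_fin ltrBlDr ltrDl.
by rewrite (@eq_infty _ y)// => r; apply: H; exact: ltry.
Qed.

(** * Weak and strong duality *)

Section Duality.
Context {R : realType} {n m s L q : nat}.
Context (a : 'I_m -> 'cV[R]_n) (b : 'I_m -> R) (hs : (s <= n)%N).
Context (c0 : 'cV[R]_n) (c : 'I_L -> 'cV[R]_n) (xi : 'I_q -> 'cV[R]_L).
Context (A0 : 'M[R]_n) (rho : R) (k0 : 'I_q) (rho_ge0 : 0 <= rho).

Local Notation cost k := (affine_cost c0 c (xi k)).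
Local Notation A := (abar a c0 c xi).
Local Notation bb := (bbar a b hs c0 c xi).
Local Notation M := (bigM a b hs c0 c xi).

Hypothesis unit_bounds : forall d : 'cV[R]_n, orthant d ->
  (forall j, dotv (a j) d = b j) ->
  forall i : 'I_s, 0 <= d (binary_index hs i) 0 <= 1.

(* Moving from [x] along a recession direction [d] with [d_i > 0] for a binary
   index [i] would violate [x_i <= 1]. *)
Lemma recession_binary0 x d : orthant x -> (forall j, dotv (a j) x = b j) ->
  orthant d -> (forall j, dotv (a j) d = 0) ->
  forall i, d (binary_index hs i) 0 = 0.
Proof.
move=> x0 ax d0 ad i; apply/eqP; apply: contraT => di.
have {}di : 0 < d (binary_index hs i) 0 by rewrite lt_neqAle eq_sym di d0.
(* This step length raises coordinate [i] by exactly 2. *)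
have xd : orthant (x + (2 / d (binary_index hs i) 0) *: d).
  by move=> j; rewrite !mxE addr_ge0// mulr_ge0// divr_ge0// ltW.
have axd j : dotv (a j) (x + (2 / d (binary_index hs i) 0) *: d) = b j.
  by rewrite dotvDr dotvZr ax ad mulr0 addr0.
have := unit_bounds xd axd i; rewrite !mxE divfK ?gt_eqF//.
by have := x0 (binary_index hs i); lra.
Qed.

Hypothesis trivial_recession : forall d : 'cV[R]_n, orthant d ->
  (forall j, dotv (a j) d = 0) -> d = 0.

(** The [sup] in [bigM] is an upper bound only if its set is bounded: [linear_bounded] bounds each
    vertex cost, and the sum of the [|N j|] bounds them all. *)
Lemma cost_le_bigM x k : feasible_RP a b hs x -> dotv (cost k) x <= M.
Proof.
move=> xF; rewrite /bigM le_max; apply/orP; left; apply: sup_ubound; last first.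
  by exists (x, k).
have /choice[N HN] k' := linear_bounded b trivial_recession (cost k').
exists (\sum_j `|N j|) => _ [[z j] /= [[az z0 _] _] <-].
apply: le_trans (HN j z z0 az) _; apply: le_trans (ler_norm _) _.
by rewrite (bigD1 j)//= lerDl sumr_ge0.
Qed.

(** With [d = 0], the first [M] row makes [y] and its slack vanish, then the cost row of [k0] (where
    [q >= 1] enters) forces [z = 0], and the remaining slacks follow. *)
Lemma lifted_recession (D : 'cV[R]_(@dualdim n q)) : orthant D ->
  (forall j, dotv (A j) D = 0) -> D = 0.
Proof.
have [d [y [z [t ->]]]] := blockv_surj D.
move=> /orthant_blockv[d0 y0 z0 t0] /(abar_blockvP _ _ _ _ (fun=> 0))[ad Hk H0 H1].
have dE : d = 0 by exact: trivial_recession.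
have t00 := t0 (rshift q 0); have t01 := t0 (rshift q 1).
have yE : y = 0 by lra.
have zE : z = 0.
  have := Hk k0; rewrite dE (dotvC _ 0) dotv0l.
  by have := t0 (lshift 2 k0); lra.
rewrite dE yE zE; have -> : t = 0.
  apply/matrixP => i j; rewrite ord1 mxE; case: (split_ordP i) => [k ->|r ->].
    by have := Hk k; rewrite dE (dotvC _ 0) dotv0l; lra.
  case: r => -[|[|//]] r.
    by have -> : Ordinal r = 0; [exact: val_inj|lra].
  by have -> : Ordinal r = 1; [exact: val_inj|lra].
apply/matrixP => i j; rewrite /blockv [RHS]mxE.
by do 3 (rewrite mxE; case: split => {}i; first by rewrite mxE); rewrite mxE.
Qed.

(** The epigraph value [y - z] is the largest vertex cost [t], split into positive and negative
    parts; the slacks are nonnegative by maximality of [t] and by [t <= M], [0 <= M]. *)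
Lemma lift_feasible x : feasible_RP a b hs x ->
  exists X, [/\ orthant X, forall j, dotv (A j) X = bb j,
    forall i, X (binary_coord hs i) 0 = x (binary_index hs i) 0
  & ((fdual A0 rho X)%:E <= worst_case c0 c xi A0 rho x)%E].
Proof.
move=> xF; have [ax x0 xB] := xF.
have [k kmax] : exists k, forall j, dotv (cost j) x <= dotv (cost k) x.
  have [k _ kmax] := arg_maxP (fun k => dotv (cost k) x) (isT : xpredT k0).
  by exists k => j; exact: kmax.
set t := dotv (cost k) x in kmax *.
have tM : t <= M by exact: cost_le_bigM.
have M0 : 0 <= M by rewrite /bigM le_max lexx orbT.
have tE : Num.max t 0 - Num.max (- t) 0 = t.
  by rewrite !maxr_absE !subr0 normrN; field.
exists (blockv x (Num.max t 0) (Num.max (- t) 0)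
  (col_mx (\col_j (t - dotv (cost j) x))
          (\col_(r < 2) if r == 0 then M - Num.max t 0 else M - t))).
split.
- apply/orthant_blockv; split; rewrite ?le_max ?lexx ?orbT//.
  apply/orthant_col_mx; split => i; rewrite mxE; first by rewrite subr_ge0 kmax.
  by case: ifP; rewrite subr_ge0// ge_max tM.
- apply/abar_bbarP; rewrite !col_mxEd !mxE /=; split => //.
  + by move=> j; rewrite col_mxEu mxE; lra.
  + lra.
  + lra.
- by move=> i; exact: blockv_binary_coord.
- by rewrite fdual_blockv tE; exact: worst_case_ge.
Qed.

Lemma weak_duality :
  (sup_DRP a b hs c0 c xi A0 rho <= inf_RP a b hs c0 c xi A0 rho)%E.
Proof.
apply: ge_ereal_sup => _ [u u0 <-]; apply: le_ereal_inf_tmp => _ [x xF <-].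
have [X [X0 AX XB XF]] := lift_feasible xF.
apply: le_trans XF; apply: ereal_inf_lbound; exists X => //.
rewrite lagrangian_feasible// => i; rewrite XB.
by have [_ _] := xF.
Qed.

Lemma strong_duality :
  (inf_RP a b hs c0 c xi A0 rho <= sup_DRP a b hs c0 c xi A0 rho)%E.
Proof.
apply: lee_real_lt => v vinf.
have [X|X|nu [mu [nu0 mu0 H]]] := quadratic_penalty (b := bb)
    (B := binary_coord hs) lifted_recession _ (Q := Wmx A0 rho) (w := wvec)
    (val := v).
- have [x [y [z [t ->]]]] := blockv_surj X.
  move=> /orthant_blockv[x0 _ _ _] /abar_bbarP[ax _ _ _] i.
  by rewrite blockv_binary_coord; exact: unit_bounds.
- have [x [y [z [t ->]]]] := blockv_surj X.
  move=> /orthant_blockv[x0 y0 z0 t0] /abar_bbarP[ax Hk _ _] xB.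
  rewrite -lte_fin -[quadfun _ _ _]/(fdual A0 rho _) fdual_blockv.
  (* The chain is [v < inf(RP) <= worst_case x <= f(X)]; for the last link, nonnegative slacks in
     the cost rows bound every vertex cost by [y - z]. *)
  apply: lt_le_trans vinf _; apply: (@le_trans _ _ (worst_case c0 c xi A0 rho x)); last first.
    by apply: worst_case_le => k; have := Hk k; have := t0 (lshift 2 k); lra.
  apply: ereal_inf_lbound; exists x => //; split => // i.
  by have := xB i; rewrite blockv_binary_coord.
apply: le_trans (ereal_sup_ubound _); last first.
  exists (penalty_multiplier a b hs c0 c xi nu mu) => //.
  exact: orthant_penalty_multiplier.
apply: le_ereal_inf_tmp => _ [X X0 <-].
by rewrite lee_fin lagrangian_penalty; exact: H.
Qed.

End Duality.

Theorem theorem4p1 (R : realType) (n m s L q : nat)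
    (a : 'I_m -> 'cV[R]_n) (b : 'I_m -> R) (hs : (s <= n)%N)
    (c0 : 'cV[R]_n) (c : 'I_L -> 'cV[R]_n)
    (xi : 'I_q -> 'cV[R]_L) (hq : (1 <= q)%N)
    (A0 : 'M[R]_n) (hA0 : A0^T = A0) (rho : R) (hrho : 0 <= rho)
    (hfeas : feasible_RP a b hs !=set0)
    (hrec : [set d : 'cV[R]_n | [/\ orthant d, forall j, dotv (a j) d = 0
                & forall i : 'I_s, d (binary_index hs i) 0 = 0]] = [set 0])
    (hRA : forall d : 'cV[R]_n, orthant d -> (forall j, dotv (a j) d = b j) ->
       forall i : 'I_s, 0 <= d (binary_index hs i) 0 <= 1) :
  inf_RP a b hs c0 c xi A0 rho = sup_DRP a b hs c0 c xi A0 rho.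
Proof.
have [x [ax x0 _]] := hfeas.
have rec0 d : orthant d -> (forall j, dotv (a j) d = 0) -> d = 0.
  (* [hrec] also asks for [d_i = 0] on the binary indices; (RA) and the feasible [x] supply it. *)
  move=> d0 ad; suff : [set 0] d by [].
  by rewrite -hrec; split => //; exact: (recession_binary0 hRA x0 ax).
apply/le_anti/andP; split.
  by apply: strong_duality => //; exact: Ordinal hq.
by apply: weak_duality => //; exact: Ordinal hq.
Qed.
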